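(* For every integer $n\ge 5$ there exists a family $\mathcal F$ of $n$ axis-parallel rectangles such that $\pi_L(\mathcal F)\ge \frac{6}{5}\,\pi(\mathcal F)$.
   Context: For a finite family $\mathcal F$ of closed axis-parallel rectangles in the plane, a point set $P\subset\mathbb R^2$ is $\mathcal F$-piercing if every translate of every rectangle in $\mathcal F$ contains a point of $P$. The density of a point set $P$ is $\limsup_{r\to\infty} |P\cap[-r,r]^2|/(2r)^2$. $\pi(\mathcal F)$ is the infimum of the densities of $\mathcal F$-piercing point sets, and $\pi_L(\mathcal F)$ is the infimum of the densities of $\mathcal F$-piercing lattices, where a lattice $\{iu+jv:i,j\in\mathbb Z\}$ ($u,v$ linearly independent) has density $1/|\det[u,v]|$. *)

(* Defs.v *)
From Stdlib Require Import Reals List ZArith.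
From Coquelicot Require Import Coquelicot.
Open Scope R_scope.

(* A closed axis-parallel rectangle, up to translation, is given by its
   width and height (both positive).  The rectangle of shape (w,h)
   translated by (a,b) is [a, a+w] x [b, b+h]. *)
Definition shape := (R * R)%type.
Definition point := (R * R)%type.

Definition valid_shape (s : shape) : Prop := 0 < fst s /\ 0 < snd s.

Definition in_translate (s : shape) (t : point) (p : point) : Prop :=
  fst t <= fst p <= fst t + fst s /\ snd t <= snd p <= snd t + snd s.

Definition piercing (F : list shape) (P : point -> Prop) : Prop :=
  forall s, In s F -> forall t : point, exists p, P p /\ in_translate s t p.

(* cardinality of a set of points, in Rbar (p_infty if infinite):
   supremum of sizes of finite duplicate-free lists contained in S *)
Definition card (S : point -> Prop) : Rbar :=
  Rbar_lub (fun y => exists l : list point,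
     NoDup l /\ (forall x, In x l -> S x) /\ y = Finite (INR (length l))).

Definition in_box (r : R) (p : point) : Prop :=
  -r <= fst p <= r /\ -r <= snd p <= r.

Definition box_ratio (P : point -> Prop) (r : R) : Rbar :=
  Rbar_mult (Finite (/ ((2 * r) ^ 2))) (card (fun p => P p /\ in_box r p)).

Definition limsup_infty (f : R -> Rbar) : Rbar :=
  Rbar_glb (fun y => exists R0 : R,
     y = Rbar_lub (fun z => exists r, R0 <= r /\ 0 < r /\ z = f r)).

Definition density (P : point -> Prop) : Rbar := limsup_infty (box_ratio P).

Definition pi_F (F : list shape) : Rbar :=
  Rbar_glb (fun d => exists P, piercing F P /\ d = density P).

Definition det2 (u v : point) : R := fst u * snd v - snd u * fst v.

Definition lattice (u v : point) (p : point) : Prop :=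
  exists i j : Z, p = (IZR i * fst u + IZR j * fst v, IZR i * snd u + IZR j * snd v).

(* pi_L(F): infimum over F-piercing lattices of their density 1/|det[u,v]| *)
Definition pi_L (F : list shape) : Rbar :=
  Rbar_glb (fun d => exists u v : point, det2 u v <> 0 /\
     piercing F (lattice u v) /\ d = Finite (/ Rabs (det2 u v))).

(* Main.v *)
(** Every lattice has bases [(a, c), (- b, d)] with [a, b, c, d >= 0], and for each of them
    the open box [(a + b) x (c + d)] spanned by the four points [0], [(a, c)], [(- b, d)] and
    their sum is empty.  So a lattice piercing the [w x h] rectangles satisfies
    [a + b <= w] or [c + d <= h] for all such bases, and Euclid's algorithm moves from one to
    the next.  For the family 1x6, 2x4, 3x3, 4x2, 6x1 there is a basis with
    [a, b, c + d <= 3]; comparing it with its neighbours bounds the determinant [a d + b c]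
    by 5.  On the other hand the non-lattice set of integer points [(i, s (i mod 6) + 6 j)],
    with [s] the permutation 0, 2, 4, 1, 5, 3, pierces the family and has density 1/6.
    Adding rectangles 1x7, 1x8, ... changes neither bound. *)

Require Import Defs.
From Stdlib Require Import Reals List ZArith Lra Lia Psatz.
From Coquelicot Require Import Coquelicot.
Import ListNotations.
Open Scope R_scope.

(** * Piercing lattices under changes of basis and symmetries *)

Definition core_family : list shape := [(1, 6); (2, 4); (3, 3); (4, 2); (6, 1)].

(** The signs are built in, so that the determinant [a * d + b * c] of the basis is a sum of
    nonnegative terms. *)
Definition pierced_basis (a b c d : R) : Prop :=
  0 <= a /\ 0 <= b /\ 0 <= c /\ 0 <= d /\
  piercing core_family (lattice (a, c) (- b, d)).

Lemma piercing_sub (F : list shape) (P Q : point -> Prop) :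
  (forall p, P p -> Q p) -> piercing F P -> piercing F Q.
Proof.
  intros PQ pF s sF t; destruct (pF s sF t) as [p [Pp inp]]; exists p; auto.
Qed.

Lemma lattice_sub (p q r s : Z) (u v : point) :
  forall x, lattice (IZR p * fst u + IZR q * fst v, IZR p * snd u + IZR q * snd v)
                    (IZR r * fst u + IZR s * fst v, IZR r * snd u + IZR s * snd v) x ->
            lattice u v x.
Proof.
  intros x [i [j ->]]; exists (i * p + j * r)%Z, (i * q + j * s)%Z; simpl.
  rewrite !plus_IZR, !mult_IZR; f_equal; ring.
Qed.

(** Writing the old basis as integer combinations of the new one shows that the new lattice contains
    the old one, which is enough for piercing. *)
Lemma piercing_change_basis (F : list shape) (p q r s : Z) (u v u' v' : point) :
  u = (IZR p * fst u' + IZR q * fst v', IZR p * snd u' + IZR q * snd v') ->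
  v = (IZR r * fst u' + IZR s * fst v', IZR r * snd u' + IZR s * snd v') ->
  piercing F (lattice u v) -> piercing F (lattice u' v').
Proof.
  intros -> ->; apply piercing_sub, lattice_sub.
Qed.

Lemma piercing_reflect (F : list shape) (x1 y1 x2 y2 : R) :
  piercing F (lattice (x1, y1) (x2, y2)) ->
  piercing F (lattice (- x1, y1) (- x2, y2)).
Proof.
  intros pF s sF t.
  destruct (pF s sF (- fst t - fst s, snd t)) as [p [[i [j ->]] [inx iny]]].
  simpl in *; eexists; split; [exists i, j; reflexivity|].
  split; simpl; lra.
Qed.

(** [core_family] is closed under exchanging width and height. *)
Lemma piercing_transpose (x1 y1 x2 y2 : R) :
  piercing core_family (lattice (x1, y1) (x2, y2)) ->
  piercing core_family (lattice (y1, x1) (y2, x2)).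
Proof.
  intros pF s sF t.
  assert (sF' : In (snd s, fst s) core_family)
    by (simpl in sF; intuition subst; simpl; tauto).
  destruct (pF _ sF' (snd t, fst t)) as [p [[i [j ->]] [inx iny]]].
  simpl in *; eexists; split; [exists i, j; reflexivity|].
  split; simpl; lra.
Qed.

Lemma pierced_basis_reflect (a b c d : R) :
  pierced_basis a b c d -> pierced_basis b a d c.
Proof.
  intros (a0 & b0 & c0 & d0 & pF); repeat split; try assumption.
  apply piercing_reflect in pF; rewrite Ropp_involutive in pF.
  revert pF; apply (piercing_change_basis _ 0 1 1 0); simpl; f_equal; ring.
Qed.

Lemma pierced_basis_transpose (a b c d : R) :
  pierced_basis a b c d -> pierced_basis c d a b.
Proof.
  intros (a0 & b0 & c0 & d0 & pF); repeat split; try assumption.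
  apply piercing_transpose in pF.
  revert pF; apply (piercing_change_basis _ 1 0 0 (-1)); simpl; f_equal; ring.
Qed.

(** Euclid's step: the sum of the two vectors replaces the first one, or the second one in
    [pierced_basis_up']. The determinant is kept and the box gets narrower and taller. The [down]
    steps use the difference instead, and follow by symmetry. *)
Lemma pierced_basis_up (a b c d : R) :
  b <= a -> pierced_basis a b c d -> pierced_basis (a - b) b (c + d) d.
Proof.
  intros ba (a0 & b0 & c0 & d0 & pF); repeat split; try lra.
  revert pF; apply (piercing_change_basis _ 1 (-1) 0 1); simpl; f_equal; ring.
Qed.

Lemma pierced_basis_up' (a b c d : R) :
  a <= b -> pierced_basis a b c d -> pierced_basis a (b - a) c (d + c).
Proof.
  now intros ab B; apply pierced_basis_reflect, pierced_basis_up, pierced_basis_reflect.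
Qed.

Lemma pierced_basis_down (a b c d : R) :
  d <= c -> pierced_basis a b c d -> pierced_basis (a + b) b (c - d) d.
Proof.
  now intros dc B; apply pierced_basis_transpose, pierced_basis_up, pierced_basis_transpose.
Qed.

Lemma pierced_basis_down' (a b c d : R) :
  c <= d -> pierced_basis a b c d -> pierced_basis a (b + a) c (d - c).
Proof.
  now intros cd B; apply pierced_basis_reflect, pierced_basis_down, pierced_basis_reflect.
Qed.

(* The open box ]-b, a[ x ]0, c + d[ contains no lattice point. *)
Lemma pierced_basis_box (w h a b c d : R) :
  In (w, h) core_family -> pierced_basis a b c d -> a + b <= w \/ c + d <= h.
Proof.
  intros sF (a0 & b0 & c0 & d0 & pF).
  destruct (Rle_lt_dec (a + b) w) as [|wab]; [now left|].
  destruct (Rle_lt_dec (c + d) h) as [|hcd]; [now right|exfalso].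
  (* The rectangle is centred in the open box. *)
  destruct (pF _ sF (- b + (a + b - w) / 2, (c + d - h) / 2))
    as [p [[i [j ->]] [inx iny]]]; simpl in inx, iny.
  (* Coefficients both at most 0 or both at least 1 put the point below or above the box; the mixed
     cases put it to the right or to the left. *)
  assert (i01 : (i <= 0 \/ 1 <= i)%Z) by lia; assert (j01 : (j <= 0 \/ 1 <= j)%Z) by lia.
  destruct i01 as [i01|i01], j01 as [j01|j01]; apply IZR_le in i01, j01; nra.
Qed.

(** * Determinants of piercing lattices, by Euclid's algorithm *)

Local Ltac in_core := simpl; tauto.
Local Ltac box B w h :=
  let W := fresh "W" in let H := fresh "H" in
  destruct (pierced_basis_box w h _ _ _ _ ltac:(in_core) B) as [W|H].
(** Splits on which of the two steps keeps all parameters nonnegative; the comparison stays in the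
    context for [nra]. *)
Local Ltac up B U V :=
  let C := fresh "C" in
  match type of B with pierced_basis ?a ?b _ _ =>
    destruct (Rle_lt_dec b a) as [C|C];
    [ pose proof (pierced_basis_up _ _ _ _ C B) as U
    | pose proof (pierced_basis_up' _ _ _ _ (Rlt_le _ _ C) B) as V] end.
Local Ltac down B U V :=
  let C := fresh "C" in
  match type of B with pierced_basis _ _ ?c ?d =>
    destruct (Rle_lt_dec d c) as [C|C];
    [ pose proof (pierced_basis_down _ _ _ _ C B) as U
    | pose proof (pierced_basis_down' _ _ _ _ (Rlt_le _ _ C) B) as V] end.
Local Ltac clearB := repeat match goal with H : pierced_basis _ _ _ _ |- _ => clear H end.
Local Ltac leaf := clearB; nra.

(** Names of bases record the steps taken from [B]. Each leaf contradicts [D] by the comparisons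
    made and the box sides bounded by rectangles. The constant 5 is sharp: the parameters 3, 1, 2, 1
    give the integer points with coordinate sum divisible by 5, which pierce the family. *)
Lemma middle_basis_det (a b c d : R) :
  pierced_basis a b c d -> b <= a -> a <= 3 -> c + d <= 3 -> a * d + b * c <= 5.
Proof.
  intros B ba a3 cd3; apply Rnot_lt_le; intros D.
  pose proof (pierced_basis_up _ _ _ _ ba B) as Bu.
  pose proof B as (_ & b0 & c0 & d0 & _).
  up Bu Buu Buv.
  - down B Bd Bd'.
    + up Buu Buuu Buuv.
      (* In this leaf [3 * b <= a] and [2 * d <= c] force [b <= 1] and [d <= 1], so
         [a * d + b * c <= 3 * d + (3 - d) <= 5]. *)
      * down Bd Bdd Bdd'; [leaf|].
        box Bdd' 6 1; leaf.
      * box Buuv 1 6; [|leaf].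
        down Bd Bdd Bdd'; [leaf|].
        box Bdd' 6 1; leaf.
    + box Bu 2 4.
      * box Buu 1 6; [|leaf]. box Bd' 4 2; leaf.
      * box Bd' 6 1; [|leaf].
        down Bd' Bdd Bdd'; [leaf|].
        box Bdd' 6 1; leaf.
  - box Buv 1 6.
    + down B Bd Bd'; [leaf|]. box Bd' 4 2; leaf.
    + down B Bd Bd'.
      * box B 4 2.
        -- up Buv Buvu Buvv; [leaf|]. box Buvv 1 6; leaf.
        -- box Buv 2 4; [leaf|]. box Bd 6 1; leaf.
      * box Buv 2 4; [|leaf].
        box Bd' 6 1; leaf.
Qed.

(* As [5 < a * d + b * c <= M * d + 3 * b], a step to the next basis lowers
   [3 * (a + b) + M * (3 - (c + d))] by more than 5. *)
Lemma low_basis_det (M : R) (n : nat) : forall a b c d : R,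
  pierced_basis a b c d -> c + d <= 3 -> a + b <= M ->
  3 * (a + b) + M * (3 - (c + d)) <= 5 * INR n -> a * d + b * c <= 5.
Proof.
  induction n as [|n IH]; intros a b c d B cd3 abM meas;
    pose proof B as (a0 & b0 & c0 & d0 & _).
  { simpl in meas.
    assert (a = 0) as -> by nra; assert (b = 0) as -> by nra; lra. }
  rewrite S_INR in meas.
  apply Rnot_lt_le; intros D.
  destruct (Rle_lt_dec b a) as [ba|ab].
  - destruct (Rle_lt_dec a 3) as [a3|a3]; [pose proof (middle_basis_det a b c d B ba a3 cd3); lra|].
    pose proof (pierced_basis_up _ _ _ _ ba B) as B'.
    (* The new box has width [a > 3], so the square forces its height to stay at most 3. *)
    destruct (pierced_basis_box 3 3 _ _ _ _ ltac:(simpl; tauto) B') as [|cdd]; [lra|].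
    specialize (IH _ _ _ _ B'); nra.
  - destruct (Rle_lt_dec b 3) as [b3|b3].
    { pose proof (middle_basis_det b a d c (pierced_basis_reflect _ _ _ _ B)); lra. }
    pose proof (pierced_basis_up' _ _ _ _ (Rlt_le _ _ ab) B) as B'.
    destruct (pierced_basis_box 3 3 _ _ _ _ ltac:(simpl; tauto) B') as [|cdd]; [lra|].
    specialize (IH _ _ _ _ B'); nra.
Qed.

Lemma exists_multiple_above (x : R) : exists n : nat, x <= 5 * INR n.
Proof.
  destruct (INR_unbounded x) as [n xn]; exists n; pose proof (pos_INR n); lra.
Qed.

(** The square makes one side of the box at most 3; a transposition turns it into the height. *)
Lemma pierced_basis_det (a b c d : R) :
  pierced_basis a b c d -> a * d + b * c <= 5.
Proof.
  intros B.
  destruct (pierced_basis_box 3 3 _ _ _ _ ltac:(simpl; tauto) B) as [ab3|cd3].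
  - destruct (exists_multiple_above (3 * (c + d) + (c + d) * (3 - (a + b)))) as [n meas].
    apply pierced_basis_transpose in B.
    pose proof (low_basis_det (c + d) n _ _ _ _ B ab3 (Rle_refl _) meas); lra.
  - destruct (exists_multiple_above (3 * (a + b) + (a + b) * (3 - (c + d)))) as [n meas].
    exact (low_basis_det (a + b) n _ _ _ _ B cd3 (Rle_refl _) meas).
Qed.

(* Subtracting [v] from [u] lowers the sum of the coordinates, which is at most [M],
   by [x2 + y2], where [5 < |det| <= M * (x2 + y2)]. *)
Lemma first_quadrant_det (M : R) (n : nat) : forall x1 y1 x2 y2 : R,
  0 <= x1 -> 0 <= y1 -> 0 <= x2 -> 0 <= y2 ->
  x1 + y1 + x2 + y2 <= M -> M * (x1 + y1 + x2 + y2) <= 5 * INR n ->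
  piercing core_family (lattice (x1, y1) (x2, y2)) ->
  Rabs (x1 * y2 - y1 * x2) <= 5.
Proof.
  induction n as [|n IH]; intros x1 y1 x2 y2 x10 y10 x20 y20 sM meas pF.
  { simpl in meas; apply Rabs_le; nra. }
  rewrite S_INR in meas.
  assert (state : forall a b c d p q r s, 0 <= a -> 0 <= b -> 0 <= c -> 0 <= d ->
    x1 = IZR p * a + IZR q * - b -> y1 = IZR p * c + IZR q * d ->
    x2 = IZR r * a + IZR s * - b -> y2 = IZR r * c + IZR s * d ->
    0 <= a * d + b * c <= 5).
  { intros a b c d p q r s a0 b0 c0 d0 ex1 ey1 ex2 ey2; split; [nra|].
    apply pierced_basis_det; repeat split; try assumption.
    revert pF; apply (piercing_change_basis _ p q r s); simpl; congruence. }
  destruct (Rle_lt_dec x2 x1) as [x21|x12]; destruct (Rle_lt_dec y2 y1) as [y21|y12].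
  - destruct (Rle_lt_dec (M * (x2 + y2)) 5) as [small|large].
    { apply Rabs_le; nra. }
    replace (x1 * y2 - y1 * x2) with ((x1 - x2) * y2 - (y1 - y2) * x2) by ring.
    apply IH; try nra.
    revert pF; apply (piercing_change_basis _ 1 1 0 1); simpl; f_equal; ring.
  (* Here the difference of the two vectors leaves the first quadrant: with one of them it forms a
     pierced basis, and the descent stops. *)
  - pose proof (state x2 (x1 - x2) y2 (y2 - y1) 1%Z (-1)%Z 1%Z 0%Z).
    apply Rabs_le; lra.
  - pose proof (state x1 (x2 - x1) y1 (y1 - y2) 1%Z 0%Z 1%Z (-1)%Z).
    apply Rabs_le; lra.
  - destruct (Rle_lt_dec (M * (x1 + y1)) 5) as [small|large].
    { apply Rabs_le; nra. }
    replace (x1 * y2 - y1 * x2) with (x1 * (y2 - y1) - y1 * (x2 - x1)) by ring.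
    apply IH; try nra.
    revert pF; apply (piercing_change_basis _ 1 0 1 1); simpl; f_equal; ring.
Qed.

(** Ordinates of opposite signs give a pierced basis once one vector is negated; two negative
    ordinates are reflected into the first quadrant. *)
Lemma right_halfplane_det (x1 y1 x2 y2 : R) :
  0 <= x1 -> 0 <= x2 ->
  piercing core_family (lattice (x1, y1) (x2, y2)) ->
  Rabs (x1 * y2 - y1 * x2) <= 5.
Proof.
  assert (quadrant : forall z1 z2, 0 <= x1 -> 0 <= x2 -> 0 <= z1 -> 0 <= z2 ->
    piercing core_family (lattice (x1, z1) (x2, z2)) ->
    Rabs (x1 * z2 - z1 * x2) <= 5).
  { intros z1 z2 x10 x20 z10 z20.
    destruct (exists_multiple_above ((x1 + z1 + x2 + z2) * (x1 + z1 + x2 + z2))) as [n meas].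
    apply (first_quadrant_det (x1 + z1 + x2 + z2) n); lra. }
  intros x10 x20 pF.
  destruct (Rle_lt_dec 0 y1) as [y10|y10]; destruct (Rle_lt_dec 0 y2) as [y20|y20].
  - now apply quadrant.
  - assert (B : pierced_basis x1 x2 y1 (- y2)).
    { repeat split; try lra.
      revert pF; apply (piercing_change_basis _ 1 0 0 (-1)); simpl; f_equal; ring. }
    apply pierced_basis_det in B; apply Rabs_le; nra.
  - assert (B : pierced_basis x2 x1 y2 (- y1)).
    { repeat split; try lra.
      revert pF; apply (piercing_change_basis _ 0 (-1) 1 0); simpl; f_equal; ring. }
    apply pierced_basis_det in B; apply Rabs_le; nra.
  - replace (x1 * y2 - y1 * x2) with (- (x1 * - y2 - - y1 * x2)) by ring.
    rewrite Rabs_Ropp; apply quadrant; try lra.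
    apply piercing_reflect in pF.
    revert pF; apply (piercing_change_basis _ (-1) 0 0 (-1)); simpl; f_equal; ring.
Qed.

Lemma piercing_lattice_det (u v : point) :
  piercing core_family (lattice u v) -> Rabs (det2 u v) <= 5.
Proof.
  destruct u as [x1 y1], v as [x2 y2]; unfold det2; simpl; intros pF.
  destruct (Rle_lt_dec 0 x1) as [x10|x10]; destruct (Rle_lt_dec 0 x2) as [x20|x20].
  - now apply right_halfplane_det.
  - replace (x1 * y2 - y1 * x2) with (- (x1 * - y2 - y1 * - x2)) by ring.
    rewrite Rabs_Ropp; apply right_halfplane_det; try lra.
    revert pF; apply (piercing_change_basis _ 1 0 0 (-1)); simpl; f_equal; ring.
  - replace (x1 * y2 - y1 * x2) with (- (- x1 * y2 - - y1 * x2)) by ring.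
    rewrite Rabs_Ropp; apply right_halfplane_det; try lra.
    revert pF; apply (piercing_change_basis _ (-1) 0 0 1); simpl; f_equal; ring.
  - replace (x1 * y2 - y1 * x2) with (- x1 * - y2 - - y1 * - x2) by ring.
    apply right_halfplane_det; try lra.
    revert pF; apply (piercing_change_basis _ (-1) 0 0 (-1)); simpl; f_equal; ring.
Qed.

(** * The non-lattice piercing pattern *)

(** In the permutation, any 2, 3 or 4 cyclically consecutive values leave gaps of at most 4, 3 or 2
    modulo 6, as the rectangles 2x4, 3x3 and 4x2 demand. The default of [nth] is never reached. *)
Definition column_height (i : Z) : Z :=
  nth (Z.to_nat (i mod 6)) [0; 2; 4; 1; 5; 3]%Z 0%Z.

Definition pattern (p : point) : Prop :=
  exists i j : Z, p = (IZR i, IZR (column_height i + 6 * j)).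

Definition range (n : nat) : list Z := map Z.of_nat (seq 0 n).

Lemma in_range (n : nat) (k : Z) : In k (range n) <-> (0 <= k < Z.of_nat n)%Z.
Proof.
  unfold range; rewrite in_map_iff; split.
  - intros [m [<- inm]]; apply in_seq in inm; lia.
  - intros kn; exists (Z.to_nat k); rewrite in_seq; lia.
Qed.

Definition window_hits (w h : nat) (i j : Z) : bool :=
  existsb (fun k => existsb (fun l => Z.eqb ((j + l) mod 6) (column_height (i + k)))
                            (range h)) (range w).

Lemma column_height_mod (i k : Z) : column_height (i mod 6 + k) = column_height (i + k).
Proof. unfold column_height; now rewrite Zplus_mod_idemp_l. Qed.

Lemma ceiling (x : R) : exists i : Z, x <= IZR i < x + 1.
Proof.
  exists (1 - up (- x))%Z; rewrite minus_IZR.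
  destruct (archimed (- x)); lra.
Qed.

(** A closed [w x h] rectangle contains a block of [w] by [h] integer points whose lower left corner
    is given by ceilings. By periodicity 36 blocks need checking, which is left to computation. *)
Lemma pattern_hits (w h : nat) (t : point) :
  forallb (fun i => forallb (window_hits w h i) (range 6)) (range 6) = true ->
  exists p, pattern p /\ in_translate (INR w, INR h) t p.
Proof.
  intros hits.
  destruct (ceiling (fst t)) as [i it], (ceiling (snd t)) as [j jt].
  rewrite forallb_forall in hits.
  pose proof (Z.mod_pos_bound i 6 eq_refl) as im.
  pose proof (Z.mod_pos_bound j 6 eq_refl) as jm.
  specialize (hits (i mod 6)%Z (proj2 (in_range 6 _) im)).
  rewrite forallb_forall in hits.
  specialize (hits (j mod 6)%Z (proj2 (in_range 6 _) jm)).
  apply existsb_exists in hits; destruct hits as [k [kw hits]].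
  apply existsb_exists in hits; destruct hits as [l [lh hits]].
  apply in_range in kw; apply in_range in lh.
  apply Z.eqb_eq in hits.
  rewrite column_height_mod, Zplus_mod_idemp_l in hits.
  exists (IZR (i + k), IZR (j + l)); split.
  - exists (i + k)%Z, ((j + l) / 6)%Z; rewrite <- hits.
    f_equal; f_equal; pose proof (Z.div_mod (j + l) 6); lia.
  - assert (kw' : (0 <= k <= Z.of_nat w - 1)%Z) by lia.
    assert (lh' : (0 <= l <= Z.of_nat h - 1)%Z) by lia.
    destruct kw' as [k0 kw'], lh' as [l0 lh'].
    apply IZR_le in k0, kw', l0, lh'.
    rewrite minus_IZR, <- INR_IZR_INZ in kw', lh'.
    split; simpl; rewrite plus_IZR; lra.
Qed.

Lemma in_translate_larger (s s' : shape) (t p : point) :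
  fst s <= fst s' -> snd s <= snd s' -> in_translate s t p -> in_translate s' t p.
Proof. unfold in_translate; intros; lra. Qed.

Definition family (n : nat) : list shape :=
  core_family ++ map (fun k => (1, 7 + INR k)) (seq 0 (n - 5)).

Lemma pattern_piercing (n : nat) : piercing (family n) pattern.
Proof.
  intros s sF t.
  apply in_app_or in sF; destruct sF as [sF|sF].
  - assert (box : forall w h, s = (INR w, INR h) ->
      forallb (fun i => forallb (window_hits w h i) (range 6)) (range 6) = true ->
      exists p, pattern p /\ in_translate s t p).
    { intros w h ->; apply pattern_hits. }
    simpl in sF; destruct sF as [<-|[<-|[<-|[<-|[<-|[]]]]]].
    + apply (box 1%nat 6%nat); [f_equal; simpl; lra|reflexivity].
    + apply (box 2%nat 4%nat); [f_equal; simpl; lra|reflexivity].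
    + apply (box 3%nat 3%nat); [f_equal; simpl; lra|reflexivity].
    + apply (box 4%nat 2%nat); [f_equal; simpl; lra|reflexivity].
    + apply (box 6%nat 1%nat); [f_equal; simpl; lra|reflexivity].
  - apply in_map_iff in sF; destruct sF as [k [<- _]].
    destruct (pattern_hits 1 6 t eq_refl) as [p [Pp inp]].
    exists p; split; [assumption|].
    revert inp; pose proof (pos_INR k).
    apply in_translate_larger; simpl; lra.
Qed.

(** * Counting and density of the pattern *)

Lemma Rbar_lub_correct (E : Rbar -> Prop) : Rbar_is_lub E (Rbar_lub E).
Proof. exact (proj2_sig (Rbar_ex_lub E)). Qed.

Lemma Rbar_glb_correct (E : Rbar -> Prop) : Rbar_is_glb E (Rbar_glb E).
Proof. exact (proj2_sig (Rbar_ex_glb E)). Qed.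

Lemma card_bound (S : point -> Prop) (box : list point) :
  (forall p, S p -> In p box) ->
  exists x, card S = Finite x /\ 0 <= x <= INR (length box).
Proof.
  intros Sbox; unfold card.
  match goal with |- exists x, Rbar_lub ?E = _ /\ _ =>
    destruct (Rbar_lub_correct E) as [ub lub]; set (L := Rbar_lub E) in * end.
  assert (L0 : Rbar_le 0 L).
  { apply ub; exists nil; repeat split; [constructor|intros x []]. }
  assert (LK : Rbar_le L (INR (length box))).
  { apply lub; intros y [l [nd [lS ->]]]; simpl; apply le_INR.
    apply NoDup_incl_length; [assumption|intros x xl; auto]. }
  destruct L as [x| |]; simpl in L0, LK; try tauto.
  now exists x.
Qed.

Lemma column_height_bound (i : Z) : (0 <= column_height i <= 5)%Z.
Proof.
  unfold column_height.
  destruct (Z.to_nat (i mod 6)) as [|[|[|[|[|[|[|]]]]]]]; simpl; lia.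
Qed.

Lemma pattern_card (k : nat) (r : R) : r <= 6 * INR k ->
  exists x, card (fun p => pattern p /\ in_box r p) = Finite x /\
    0 <= x <= (12 * INR k + 1) * (2 * INR k + 1).
Proof.
  intros rk.
  set (box := map (fun ij => (IZR (fst ij), IZR (column_height (fst ij) + 6 * snd ij)))
    (list_prod (map (fun i => (i - 6 * Z.of_nat k)%Z) (range (12 * k + 1)))
               (map (fun j => (j - Z.of_nat k)%Z) (range (2 * k + 1))))).
  replace ((12 * INR k + 1) * (2 * INR k + 1)) with (INR (length box)).
  2:{ unfold box, range.
      rewrite length_map, length_prod, !length_map, !length_seq, mult_INR, !plus_INR, !mult_INR.
      simpl; ring. }
  apply card_bound.
  intros p [[i [j ->]] [inx iny]]; cbn [fst snd] in inx, iny.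
  rewrite INR_IZR_INZ in rk.
  assert (ib : (- (6 * Z.of_nat k) <= i <= 6 * Z.of_nat k)%Z).
  { split; apply le_IZR; rewrite ?opp_IZR, mult_IZR; lra. }
  assert (jb : (- (6 * Z.of_nat k) <= column_height i + 6 * j <= 6 * Z.of_nat k)%Z).
  { split; apply le_IZR; rewrite ?opp_IZR, (mult_IZR 6 (Z.of_nat k)); lra. }
  (* Heights between 0 and 5 turn [jb] into [- k <= j <= k]. *)
  pose proof (column_height_bound i).
  apply in_map_iff; exists (i, j); split; [reflexivity|].
  apply in_prod; apply in_map_iff.
  - exists (i + 6 * Z.of_nat k)%Z; split; [|apply in_range]; lia.
  - exists (j + Z.of_nat k)%Z; split; [|apply in_range]; lia.
Qed.

Lemma pattern_box_ratio (r : R) : 1 <= r ->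
  Rbar_le (box_ratio pattern r) (1 / 6 + 13 / r).
Proof.
  intros r1.
  destruct (ceiling (r / 6)) as [z [rz zr]].
  assert (z0 : (0 <= z)%Z) by (apply le_IZR; lra).
  destruct (Z_of_nat_complete z z0) as [k ->].
  rewrite <- INR_IZR_INZ in rz, zr.
  destruct (pattern_card k r) as [x [cx [x0 xk]]]; [lra|].
  unfold box_ratio; rewrite cx; simpl.
  (* By the choice of the ceiling, [6 * INR k < r + 6]. Expanding gives
     [3 * x <= 2 * r * r + 31 * r + 117 / 1], within [156 * r] of the main term since [r >= 1]; this
     is where 13 comes from. *)
  assert (xr : x <= (2 * r + 13) * (r + 9) / 3) by nra.
  apply (Rmult_le_reg_l (12 * r * r)); [nra|].
  replace (12 * r * r * (/ (2 * r * (2 * r * 1)) * x)) with (3 * x) by (field; lra).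
  replace (12 * r * r * (1 / 6 + 13 / r)) with (2 * r * r + 156 * r) by (field; lra).
  nra.
Qed.

Lemma pattern_density : Rbar_le (density pattern) (1 / 6).
Proof.
  assert (approx : forall e, 0 < e -> Rbar_le (density pattern) (1 / 6 + e)).
  { intros e e0; unfold density, limsup_infty.
    match goal with |- Rbar_le (Rbar_glb ?E) _ =>
      destruct (Rbar_glb_correct E) as [lb _] end.
    (* Beyond [13 / e] the error term [13 / r] is at most [e]. *)
    eapply Rbar_le_trans; [apply lb; exists (Rmax 1 (13 / e)); reflexivity|].
    match goal with |- Rbar_le (Rbar_lub ?E) _ =>
      destruct (Rbar_lub_correct E) as [_ lub] end.
    apply lub; intros y [r [Rr [r0 ->]]].
    pose proof (Rmax_l 1 (13 / e)); pose proof (Rmax_r 1 (13 / e)).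
    eapply Rbar_le_trans; [apply pattern_box_ratio; lra|].
    simpl; apply Rplus_le_compat_l.
    apply (Rmult_le_reg_l (r / e)); [apply Rdiv_lt_0_compat; lra|].
    replace (r / e * (13 / r)) with (13 / e) by (field; lra).
    replace (r / e * e) with r by (field; lra).
    lra. }
  destruct (density pattern) as [x| |]; simpl in *.
  - apply Rnot_lt_le; intros xl.
    pose proof (approx ((x - 1 / 6) / 2)); lra.
  - exact (approx 1 Rlt_0_1).
  - exact I.
Qed.

Theorem theorem7 : forall n : nat, (5 <= n)%nat ->
  exists F : list shape,
    length F = n /\ NoDup F /\ (forall s, In s F -> valid_shape s) /\
    Rbar_le (Rbar_mult (Finite (6 / 5)) (pi_F F)) (pi_L F).
Proof.
  intros n n5; exists (family n); unfold family; split; [|split; [|split]].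
  - rewrite length_app, length_map, length_seq; simpl; lia.
  - apply NoDup_app.
    + unfold core_family; repeat constructor; simpl; intros H; decompose [or] H;
        try tauto; match goal with E : (_, _) = _ |- _ => injection E; intros; lra end.
    + apply NoDup_map_NoDup_ForallPairs; [|apply seq_NoDup].
      intros k l _ _ E; injection E; intros E'; apply INR_eq; lra.
    + intros s sF sM; apply in_map_iff in sM; destruct sM as [k [<- _]].
      pose proof (pos_INR k).
      simpl in sF; decompose [or] sF; try tauto;
        match goal with E : (_, _) = _ |- _ => injection E; intros; lra end.
  - intros s sF; apply in_app_or in sF; destruct sF as [sF|sF].
    + simpl in sF; decompose [or] sF; subst; try tauto; split; simpl; lra.
    + apply in_map_iff in sF; destruct sF as [k [<- _]].
      pose proof (pos_INR k); split; simpl; lra.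
  - fold (family n).
    assert (upper : Rbar_le (pi_F (family n)) (1 / 6)).
    { eapply Rbar_le_trans; [|exact pattern_density].
      apply (proj1 (Rbar_glb_correct _)).
      exists pattern; split; [apply pattern_piercing|reflexivity]. }
    assert (lower : Rbar_le (1 / 5) (pi_L (family n))).
    { apply (proj2 (Rbar_glb_correct _)).
      intros y [u [v [det0 [pF ->]]]].
      assert (det5 : Rabs (det2 u v) <= 5).
      { apply piercing_lattice_det; intros s sF.
        apply pF; unfold family; apply in_or_app; now left. }
      simpl; replace (1 / 5) with (/ 5) by field.
      apply Rinv_le_contravar; [now apply Rabs_pos_lt|assumption]. }
    apply Rbar_le_trans with (2 := lower).
    destruct (pi_F (family n)) as [x| |]; simpl in upper; try tauto.
    + simpl; lra.
    (* For the value [m_infty], [Rbar_mult] branches on the sign of the factor. *)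
    + simpl; destruct (Rle_dec 0 (6 / 5)) as [pos|neg]; [|lra].
      destruct (Rle_lt_or_eq_dec _ _ pos); simpl; [exact I|lra].
Qed.
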